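(* Let $C$ be the binary $[23,12,7]$ Golay code (with $q=2$) or the ternary $[11,6,5]$ Golay code (with $q=3$). Then the $\sigma_q$-invariant polynomial $\tilde W_C(x,y)$ satisfies the Riemann hypothesis.
   Context: For a linear $[n,k]$ code $C$ over $\mathbf{F}_q$, $W_C(x,y)=\sum_{c\in C}x^{n-\mathrm{wt}(c)}y^{\mathrm{wt}(c)}$ is its Hamming weight enumerator, $C^\perp$ is its dual code, and $$\tilde W_C(x,y)=\frac{1}{1+q^{k-n/2}}\left\{W_C(x,y)+q^{k-n/2}W_{C^\perp}(x,y)\right\}.$$ The weight enumerators of the binary Golay code $\mathcal{G}_{23}$, the ternary Golay code $\mathcal{G}_{11}$ and their duals are $$W_{\mathcal{G}_{23}}=x^{23}+253x^{16}y^7+506x^{15}y^8+1288x^{12}y^{11}+1288x^{11}y^{12}+506x^{8}y^{15}+253x^7y^{16}+y^{23},$$ $$W_{\mathcal{G}_{23}^\perp}=x^{23}+506x^{15}y^8+1288x^{11}y^{12}+253x^7y^{16},$$ $$W_{\mathcal{G}_{11}}=x^{11}+132x^6y^5+132x^5y^6+330x^3y^8+110x^2y^9+24y^{11},\qquad W_{\mathcal{G}_{11}^\perp}=x^{11}+132x^5y^6+110x^2y^9.$$ MacWilliams transform: $\sigma_q=\frac{1}{\sqrt q}\begin{pmatrix}1&q-1\\1&-1\end{pmatrix}$; for $f(x,y)\in\mathbf{C}[x,y]$ and $\sigma=\begin{pmatrix}a&b\\c&e\end{pmatrix}$, $f^\sigma(x,y)=f(ax+by,cx+ey)$; $f$ is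 $\sigma_q$-invariant if $f^{\sigma_q}=f$. Zeta polynomial: for a homogeneous polynomial $W(x,y)=x^n+\sum_{i=\delta}^n A_i x^{n-i}y^i$ ($A_i\in\mathbf{C}$, $A_\delta\ne0$), the zeta polynomial $P(T)\in\mathbf{C}[T]$ of $W$ (with respect to $q$) is the unique polynomial of degree at most $n-\delta$ such that the coefficient of $T^{n-\delta}$ in the power series expansion in $T$ of $\frac{P(T)}{(1-T)(1-qT)}(y(1-T)+xT)^n$ equals $\frac{W(x,y)-x^n}{q-1}$. (Such a polynomial exists and is unique.) Riemann hypothesis: a $\sigma_q$-invariant polynomial satisfies the Riemann hypothesis if all the zeros of its zeta polynomial have the same absolute value $1/\sqrt q$. *)

(* Defs.v *)
From HB Require Import structures.
From mathcomp Require Import all_boot all_order all_fingroup all_algebra.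
From mathcomp Require Import mpoly.

Set Implicit Arguments.
Unset Strict Implicit.
Unset Printing Implicit Defensive.

Import GRing.Theory Num.Theory.

Local Open Scope ring_scope.

(* Polynomials f(x,y) are elements of {mpoly K[2]}, with x the variable of
   index 0 and y the variable of index 1. *)
Definition polyx (K : nzRingType) : {mpoly K[2]} := 'X_ord0.
Definition polyy (K : nzRingType) : {mpoly K[2]} := 'X_ord_max.

(** Linear codes of length n over F are the subspaces {vspace 'rV[F]_n}. *)

Section Codes.
Variables (F : finFieldType) (n : nat).

Definition wt (c : 'rV[F]_n) : nat := #|[set i | c 0 i != 0]|.

Definition dual_code (C : {vspace 'rV[F]_n}) : {vspace 'rV[F]_n} :=
  (\bigcap_(c : 'rV[F]_n | c \in C)
     lker (linfun (fun v : 'rV[F]_n => v *m c^T : 'rV[F]_1)))%VS.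

Lemma mem_dual_code (C : {vspace 'rV[F]_n}) (v : 'rV[F]_n) :
  reflect (forall c, c \in C -> \sum_(i < n) v 0 i * c 0 i = 0)
          (v \in dual_code C).
Proof.
have lin (c : 'rV[F]_n) :
    linfun (fun v : 'rV[F]_n => v *m c^T : 'rV[F]_1) v = v *m c^T.
  exact: (lfunE (mulmxr c^T : {linear 'rV[F]_n -> 'rV[F]_1})).
have dotE (c : 'rV[F]_n) :
    (v *m c^T == 0 :> 'rV[F]_1) = (\sum_(i < n) v 0 i * c 0 i == 0).
  apply/eqP/eqP => [/matrixP/(_ 0 0)|dot0]; last apply/matrixP=> i j.
    rewrite !mxE => dot0; rewrite -[RHS]dot0.
    by apply: eq_bigr => i _; rewrite mxE.
  by rewrite !ord1 !mxE -[RHS]dot0; apply: eq_bigr => k _; rewrite mxE.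
apply: (iffP idP) => [/[swap] c /[swap] cC|dotC].
  rewrite memvE => /subv_bigcapP/(_ c cC).
  by rewrite -memvE memv_ker lin dotE => /eqP.
rewrite memvE; apply/subv_bigcapP => c cC.
by rewrite -memvE memv_ker lin dotE dotC.
Qed.

(* Monomial equivalence: D is obtained from C by permuting the coordinates
   and multiplying each of them by a nonzero scalar. *)
Definition code_equiv (C D : {vspace 'rV[F]_n}) : Prop :=
  exists (s : 'S_n) (d : 'I_n -> F), (forall i, d i != 0) /\
    forall c : 'rV[F]_n, (c \in C) = (\row_i (d i * c 0 (s i)) \in D).

(* The code with generator matrix rows g, X g, ..., X^(k-1) g, a polynomial
   being identified with its vector of coefficients; it is the cyclic code of
   dimension k generated by g when g has degree n - k and divides X^n - 1. *)
Definition generated_code (k : nat) (g : {poly F}) : {vspace 'rV[F]_n} :=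
  <<[seq poly_rV ('X^i * g) | i <- iota 0 k]>>%VS.

End Codes.

(* The Golay codes are only defined up to equivalence.  The standard
   generator polynomials are divisors of X^23 - 1 over F_2 and of X^11 - 1
   over F_3. *)
Definition binary_golay (C : {vspace 'rV['F_2]_23}) : Prop :=
  code_equiv C
    (generated_code 23 12 ('X^11 + 'X^9 + 'X^7 + 'X^6 + 'X^5 + 'X + 1)).

Definition ternary_golay (C : {vspace 'rV['F_3]_11}) : Prop :=
  code_equiv C (generated_code 11 6 ('X^5 + 'X^4 - 'X^3 + 'X^2 - 1)).

Section WeightEnumerators.
Variable K : numClosedFieldType.

Definition weight_enum (F : finFieldType) (n : nat) (C : {vspace 'rV[F]_n}) :
    {mpoly K[2]} :=
  \sum_(c : 'rV[F]_n | c \in C) polyx K ^+ (n - wt c) * polyy K ^+ wt c.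

(* Here r is q^(k - n/2), with k the dimension of C. *)
Definition tilde_weight_enum (F : finFieldType) (n : nat)
    (C : {vspace 'rV[F]_n}) : {mpoly K[2]} :=
  let q : K := #|F|%:R in
  let r := q ^+ \dim C / sqrtC q ^+ n in
  (1 + r)^-1 *: (weight_enum C + r *: weight_enum (dual_code C)).

Definition sigma (q : nat) : 'M[K]_2 :=
  (sqrtC q%:R)^-1 *:
  \matrix_(i, j) nth 0 (nth [::] [:: [:: 1; q%:R - 1]; [:: 1; -1]] i) j.

Definition mx_subst (f : {mpoly K[2]}) (s : 'M[K]_2) : {mpoly K[2]} :=
  f \mPo [tuple \sum_(j < 2) s i j *: 'X_j | i < 2].

Definition sigma_invariant (q : nat) (f : {mpoly K[2]}) : Prop :=
  mx_subst f (sigma q) = f.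

End WeightEnumerators.

(** Formal power series, as sequences of coefficients. *)

Section PowerSeries.
Variable A : nzRingType.

Definition series_mul (s t : nat -> A) : nat -> A :=
  fun m => \sum_(i < m.+1) s i * t (m - i)%N.

Definition series_of_poly (p : {poly A}) : nat -> A := fun m => p`_m.

(* The expansion of 1 / (1 - a T). *)
Definition series_geom (a : A) : nat -> A := fun m => a ^+ m.

Lemma series_geomP (a : A) :
  series_mul (series_of_poly (1 - a *: 'X)) (series_geom a) =1
  series_of_poly 1.
Proof.
case=> [|m]; rewrite /series_mul /series_of_poly /series_geom.
  by rewrite big_ord1 !coefE mulr1 mulr0 subr0.
rewrite 2!big_ord_recl big1 => [|i _]; rewrite !coefE /=.
  by rewrite subn0 subSS subn0 mulr0 mulr1 subr0 sub0r addr0 mul1r mulNr -exprS subrr.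
by rewrite mulr0 subr0 mul0r.
Qed.

End PowerSeries.

Section Zeta.
Variable K : numClosedFieldType.

Definition weight_form (n delta : nat) (W : {mpoly K[2]}) : Prop :=
  (0 < delta <= n)%N /\
  exists A : nat -> K, A delta != 0 /\
    W = polyx K ^+ n
        + \sum_(delta <= i < n.+1) A i *: (polyx K ^+ (n - i) * polyy K ^+ i).

(* The expansion of P(T) / ((1 - T)(1 - q T)) (y (1 - T) + x T)^n in powers
   of T, the coefficients being polynomials in x and y. *)
Definition zeta_series (q n : nat) (P : {poly K}) : nat -> {mpoly K[2]} :=
  series_mul
    (series_mul (series_of_poly (map_poly (@mpolyC 2 K) P))
                (series_mul (series_geom 1) (series_geom q%:R)))
    (series_of_poly
       (((polyy K)%:P * (1 - 'X) + (polyx K)%:P * 'X) ^+ n)).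

Definition is_zeta_poly (q n delta : nat) (W : {mpoly K[2]}) (P : {poly K}) :
    Prop :=
  (size P <= (n - delta).+1)%N /\
  zeta_series q n P (n - delta)%N = (q%:R - 1)^-1 *: (W - polyx K ^+ n).

(* The degree n and the index delta are determined by W. *)
Definition riemann_hypothesis (q : nat) (W : {mpoly K[2]}) : Prop :=
  exists n delta : nat,
    [/\ weight_form n delta W,
        exists! P : {poly K}, is_zeta_poly q n delta W P
      & forall P : {poly K}, is_zeta_poly q n delta W P ->
          forall z : K, root P z -> `|z| = (sqrtC q%:R)^-1].

End Zeta.

(* Main.v *)
From Stdlib Require Import BinNat.
Require Import Defs.
From mathcomp Require Import all_boot all_order all_fingroup all_algebra.
From mathcomp Require Import ring lra ssrZ.
From mathcomp Require Import finfield polyrcf mpoly reals complex.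

Set Implicit Arguments.
Unset Strict Implicit.
Unset Printing Implicit Defensive.
Import Order.TTheory GRing.Theory Num.Theory.
Local Open Scope ring_scope.

(** Both codes have n = 2k - 1, so the factor q^(k - n/2) is sqrt q, and the
    polynomial under study is (W_C + sqrt q W_C') / (1 + sqrt q), where C' is
    the dual code.  The transform sigma_q is an involution which sends W_C to
    sqrt q W_C' (MacWilliams identity, lemma [mx_subst_weight_enum]); hence it
    fixes this polynomial.

    The Golay code C is a punctured, and C' a shortened, version of one and
    the same extended (self-dual) Golay code.  As a result the zeta polynomial
    P0 of the extended code accounts for both weight enumerators: with n - d
    the degree in T at which W_C - x^n is read off from P0, the polynomial
    W_C' - x^n is read off at degree n - d - 1, which is to say from T P0 at
    degree n - d.  The zeta polynomial is therefore
    P0 (1 + sqrt q T) / (1 + sqrt q) ([riemann_hypothesis_of_moments]), and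
    the linear factor has its root on the circle |T| = 1 / sqrt q.

    The roots of P0 remain.  Up to a constant P0 is 3 T^2 + 3 T + 1 when
    q = 3, and when q = 2 it is T^5 Q(2 T + 1/T) for a quintic Q.  If T is not
    zero and q T + 1/T is a real number less than 2 sqrt q in absolute value,
    then |T| = 1 / sqrt q ([norm_of_real_sum]).  For q = 3 this real number is
    -3.  For q = 2 it is a root of Q, and five sign changes show that Q has
    all its roots in the interval from -14/5 to 1
    ([golay_quintic_complex_root]).

    The input is the weight distribution of C, found by listing the multiples
    of the generator polynomial ([golay23_distribution],
    [golay11_distribution]).  The one of C' follows by the MacWilliams
    identity.  The relation between weights and zeta polynomial becomes, in
    the basis y^(n-k) (x - y)^k, a list of numerical identities between
    binomial moments of the weights and coefficients of the power series
    P0(T) / ((1 - T)(1 - q T)) ([zeta_series_of_moments]). *)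

(** * The MacWilliams identity *)

Section MacWilliams.
Variables (F : finFieldType) (n : nat) (A : idomainType).

Definition enumerator (C : {vspace 'rV[F]_n}) (x y : A) : A :=
  \sum_(c : 'rV[F]_n | c \in C) x ^+ (n - wt c) * y ^+ wt c.

(** A product over the coordinates, so that its Fourier transform can be taken
    one coordinate at a time. *)
Lemma weight_monomialE (x y : A) (c : 'rV[F]_n) :
  x ^+ (n - wt c) * y ^+ wt c = \prod_(i < n) (if c 0 i == 0 then x else y).
Proof.
rewrite (bigID (fun i => c 0 i == 0)) /=.
rewrite (eq_bigr (fun=> x)) => [|i ->//].
rewrite [X in _ = _ * X](eq_bigr (fun=> y)) => [|i /negPf->//].
rewrite !prodr_const; congr (x ^+ _ * y ^+ _); last by rewrite /wt cardsE.
rewrite -{1}(card_ord n) -(cardC [pred i | c 0 i == 0]) /wt cardsE.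
by rewrite -[X in (_ + _ - X)%N](@eq_card _ (predC [pred i | c 0 i == 0])) ?addnK.
Qed.

(** Translation by [g] permutes the summands and multiplies the sum by
    [psi g], which differs from 1. *)
Lemma sum_character_eq0 (G : finZmodType) (S : pred G) (psi : G -> A) (g : G) :
    (forall u v, psi (u + v) = psi u * psi v) -> psi g != 1 ->
    (forall u, S (u + g) = S u) ->
  \sum_(u | S u) psi u = 0.
Proof.
move=> psiD psi_g Sg; set s := \sum_(u | _) _.
have sE : s = s * psi g.
  rewrite mulr_suml {1}/s (reindex_inj (addIr g)) /=.
  by apply: eq_big => [u|u _]; rewrite ?Sg ?psiD.
apply/eqP; move/eqP: sE; rewrite -subr_eq0 -{1}[s]mulr1 -mulrBr mulf_eq0.
by rewrite subr_eq0 [1 == _]eq_sym (negPf psi_g) orbF.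
Qed.

Variable chi : F -> A.
Hypothesis chi0 : chi 0 = 1.
Hypothesis chiD : forall a b, chi (a + b) = chi a * chi b.
Hypothesis chi_nontrivial : exists b, chi b != 1.

Let dot (v u : 'rV[F]_n) := \sum_(i < n) v 0 i * u 0 i.

Lemma sum_character_scaled (b : F) :
  \sum_a chi (a * b) = if b == 0 then #|F|%:R else 0.
Proof.
have [->|b0] := eqVneq.
  by under eq_bigr do rewrite mulr0 chi0; rewrite sumr_const.
have [c chi_c] := chi_nontrivial.
apply: (@sum_character_eq0 _ predT _ (c / b)) => // [u v|].
  by rewrite mulrDl chiD.
by rewrite divfK.
Qed.

(** If [v] is not orthogonal to some [u] in [C], then [dot v] takes all values
    on the multiples of [u], among them one at which [chi] is nontrivial. *)
Lemma sum_character_code (C : {vspace 'rV[F]_n}) (v : 'rV[F]_n) :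
  \sum_(u : 'rV[F]_n | u \in C) chi (dot v u) =
  if v \in dual_code C then (#|F| ^ \dim C)%:R else 0.
Proof.
case: ifPn => [/mem_dual_code vC|vC].
  rewrite (eq_bigr (fun=> 1)) => [|u /vC dot0]; last by rewrite /dot dot0 chi0.
  by rewrite sumr_const -card_vspace.
have [u uC dot_u] : exists2 u : 'rV[F]_n, u \in C & dot v u != 0.
  have [/existsP[u /andP[]]|] := boolP [exists u : 'rV[F]_n, (u \in C) && (dot v u != 0)].
    by exists u.
  rewrite negb_exists => /forallP vC'; case/negP: vC; apply/mem_dual_code => u uC.
  by move: (vC' u); rewrite uC negbK => /eqP.
have [b chi_b] := chi_nontrivial.
apply: (@sum_character_eq0 _ _ (fun u => chi (dot v u)) ((b / dot v u) *: u)).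
- move=> w w'; rewrite -chiD; congr chi; rewrite -big_split /=.
  by apply: eq_bigr => i _; rewrite mxE mulrDr.
- suff -> : dot v ((b / dot v u) *: u) = b by [].
  rewrite -[RHS](divfK dot_u) {3}/dot mulr_sumr.
  by apply: eq_bigr => i _; rewrite mxE mulrCA.
- by move=> w; rewrite rpredDr // rpredZ.
Qed.

(** Poisson summation over [C] for the function
    [v |-> x ^+ (n - wt v) * y ^+ wt v].  The Fourier transform of the factor
    at one coordinate is x + (q - 1) y at 0 and x - y elsewhere, so the
    transform is the same monomial in these two forms. *)
Lemma macwilliams_of_character (C : {vspace 'rV[F]_n}) (x y : A) :
  enumerator C (x + #|F|.-1%:R * y) (x - y) =
  (#|F| ^ \dim C)%:R * enumerator (dual_code C) x y.
Proof.
pose f (a : F) := if a == 0 then x else y.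
have coordE b : \sum_a f a * chi (a * b) =
    if b == 0 then x + #|F|.-1%:R * y else x - y.
  have sE : \sum_a f a * chi (a * b) = y * \sum_a chi (a * b) + (x - y).
    rewrite mulr_sumr (bigD1 0) //= [in RHS](bigD1 0) //= /f eqxx mul0r chi0.
    rewrite !mulr1 [RHS]addrAC [y + _]addrC subrK; congr (_ + _).
    by apply: eq_bigr => a /negPf ->.
  rewrite sE sum_character_scaled; case: (b == 0); last by rewrite mulr0 add0r.
  have F0 : (0 < #|F|)%N by apply/card_gt0P; exists 0.
  by rewrite -{1}(prednK F0) -natr1; ring.
transitivity (\sum_(u : 'rV[F]_n | u \in C) \sum_(v : 'rV[F]_n)
    (\prod_(i < n) f (v 0 i)) * chi (dot v u)).
  apply: eq_bigr => u _; rewrite weight_monomialE.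
  rewrite (eq_bigr (fun i => \sum_a f a * chi (a * u 0 i))) => [|i _]; last first.
    by rewrite coordE.
  rewrite bigA_distr_bigA /=.
  rewrite (reindex (fun v : 'rV[F]_n => [ffun i => v 0 i])) /=; last first.
    exists (fun g : {ffun 'I_n -> F} => \row_i g i) => [v|g] _.
      by apply/rowP => i; rewrite mxE ffunE.
    by apply/ffunP => i; rewrite ffunE mxE.
  apply: eq_bigr => v _; rewrite big_split /=; congr (_ * _).
    by apply: eq_bigr => i _; rewrite ffunE.
  rewrite (big_morph chi chiD chi0).
  by apply: eq_bigr => i _; rewrite ffunE.
rewrite exchange_big /= mulr_sumr [RHS]big_mkcond /=.
apply: eq_bigr => v _; rewrite -mulr_sumr sum_character_code weight_monomialE.
by case: ifP => _; rewrite ?mulr0 // mulrC.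
Qed.
End MacWilliams.

Section PrimeCharacter.
Variables (K : numClosedFieldType) (p : nat).
Hypothesis p_pr : prime p.

(** A root of 1 + X + ... + X^(p-1) will do: the value of this polynomial at 1
    is p, which is not zero in [K]. *)
Lemma nontrivial_root_of_unity : exists2 w : K, w ^+ p = 1 & w != 1.
Proof.
have p1 := prime_gt1 p_pr.
pose f : {poly K} := \poly_(i < p) 1.
have sz_f : size f = p.
  by rewrite /f size_poly_eq // oner_eq0.
have /closed_rootP[w /rootP fw] : size f != 1 by rewrite sz_f; case: (p) p1 => [|[]].
move: fw; rewrite horner_poly => fw.
have wE : w ^+ p - 1 = 0.
  rewrite subrX1 -[RHS](mulr0 (w - 1)) -[in RHS]fw; congr (_ * _).
  by apply: eq_bigr => i _; rewrite mul1r.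
exists w; first by apply/eqP; rewrite -subr_eq0 wE.
apply: contra_eqN fw => /eqP ->.
rewrite (eq_bigr (fun=> 1)) => [|i _]; last by rewrite expr1n mulr1.
by rewrite sumr_const card_ord pnatr_eq0 -lt0n prime_gt0.
Qed.

Lemma prime_field_character : exists chi : 'F_p -> K,
  [/\ chi 0 = 1, forall a b, chi (a + b) = chi a * chi b & chi 1 != 1].
Proof.
have [w wp w1] := nontrivial_root_of_unity.
exists (fun a : 'F_p => w ^+ a); split=> [|a b|]; rewrite ?expr0 //=.
  by rewrite [X in (_ %% X)%N](Fp_cast p_pr) expr_mod // exprD.
Qed.

End PrimeCharacter.

Section MacWilliamsTransform.
Variables (K : numClosedFieldType) (q : nat).
Hypothesis q0 : (0 < q)%N.
Local Notation x := (polyx K).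
Local Notation y := (polyy K).
Local Notation sq := (sqrtC (q%:R : K)).

Lemma sqrt_neq0 : sq != 0.
Proof. by rewrite sqrtC_eq0 pnatr_eq0 -lt0n. Qed.

Lemma sqrt_sqr : sq * sq = q%:R.
Proof. by rewrite -expr2 sqrtCK. Qed.

Lemma mx_subst_x : mx_subst x (sigma K q) = sq^-1 *: (x + q.-1%:R * y).
Proof.
rewrite /mx_subst /polyx comp_mpolyXU -tnth_nth tnth_mktuple.
rewrite big_ord_recl big_ord1 !mxE /= mulr1 -scalerA -scalerDr; congr (_ *: (_ + _)).
rewrite -{1}(prednK q0) -natr1 addrK scaler_nat mulr_natl.
by congr ('X_ _ *+ _); apply: val_inj.
Qed.

Lemma mx_subst_y : mx_subst y (sigma K q) = sq^-1 *: (x - y).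
Proof.
rewrite /mx_subst /polyy comp_mpolyXU -tnth_nth tnth_mktuple.
rewrite big_ord_recl big_ord1 !mxE /= mulr1 -scalerA -scalerDr scaleN1r.
by congr (_ *: (_ - 'X_ _)); apply: val_inj.
Qed.

(** The matrix has square 1 because 1 + (q - 1) = q.  Substitution is a ring
    morphism, so it is enough to look at the two variables. *)
Lemma sigma_involutive (f : {mpoly K[2]}) :
  mx_subst (mx_subst f (sigma K q)) (sigma K q) = f.
Proof.
set t := [tuple \sum_(j < 2) sigma K q i j *: 'X_j | i < 2] : 2.-tuple {mpoly K[2]}.
have substE h : mx_subst h (sigma K q) = h \mPo t by [].
have qE : 1 + q.-1%:R = q%:R :> {mpoly K[2]} by rewrite -{2}(prednK q0) mulrS.
pose s : {mpoly K[2]} := (sq^-1)%:MP.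
have ssq : s * s * q%:R = 1.
  rewrite -mpolyCM -invfM sqrt_sqr -(rmorph_nat (@mpolyC 2 K)) -mpolyCM.
  by rewrite mulVf ?pnatr_eq0 -?lt0n.
have st : s \mPo t = s by rewrite comp_mpolyC.
have xt : x \mPo t = s * (x + q.-1%:R * y) by rewrite -substE mx_subst_x mul_mpolyC.
have yt : y \mPo t = s * (x - y) by rewrite -substE mx_subst_y mul_mpolyC.
have tt (i : 'I_2) : tnth t i \mPo t = 'X_i.
  have -> : tnth t i = 'X_i \mPo t by rewrite comp_mpolyXU -tnth_nth.
  have [->|->] : i = ord0 \/ i = ord_max.
    by case: i => [[|[|//]]] ?; [left|right]; apply: val_inj.
  - rewrite -/x xt !rmorphM rmorphD /= rmorphM rmorph_nat st xt /= yt.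
    by transitivity (s * s * (1 + q.-1%:R) * x); [ring | rewrite qE ssq mul1r].
  - rewrite -/y yt !rmorphM rmorphB /= st xt yt.
    by transitivity (s * s * (1 + q.-1%:R) * y); [ring | rewrite qE ssq mul1r].
rewrite !substE [f \mPo t]comp_mpolyEX rmorph_sum /= -[RHS]comp_mpoly_id.
rewrite [RHS]comp_mpolyEX; apply: eq_bigr => m _.
rewrite !comp_mpolyZ; congr (_ *: _); rewrite !comp_mpolyX rmorph_prod.
by apply: eq_bigr => i _; rewrite rmorphXn /= tt tnth_mktuple.
Qed.

End MacWilliamsTransform.

Section PrimeFieldCodes.
Variables (K : numClosedFieldType) (p n : nat).
Hypothesis p_pr : prime p.
Implicit Type C : {vspace 'rV['F_p]_n}.
Local Notation x := (polyx K).
Local Notation y := (polyy K).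
Local Notation sq := (sqrtC (p%:R : K)).

Lemma macwilliams C :
  enumerator C (x + p.-1%:R * y) (x - y) =
  (p ^ \dim C)%:R * enumerator (dual_code C) x y.
Proof.
have [chi [chi0 chiD chi1]] := prime_field_character K p_pr.
have := @macwilliams_of_character _ n _ (fun a => (chi a)%:MP : {mpoly K[2]}).
rewrite card_Fp //; apply=> [|a b|]; rewrite ?chi0 ?chiD ?mpolyCM //.
by exists 1; rewrite -mpolyC1 mpolyC_eq.
Qed.

Lemma mx_subst_weight_enum C :
  mx_subst (weight_enum K C) (sigma K p) =
  (p%:R ^+ \dim C / sq ^+ n) *: weight_enum K (dual_code C).
Proof.
have p0 := prime_gt0 p_pr.
transitivity ((sq ^+ n)^-1 *: enumerator C (x + p.-1%:R * y) (x - y)).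
  rewrite /mx_subst rmorph_sum /= scaler_sumr; apply: eq_bigr => c _.
  have wt_c : (wt c <= n)%N by rewrite -[X in (_ <= X)%N]card_ord max_card.
  rewrite rmorphM /= !rmorphXn /= -!/(mx_subst _ _) mx_subst_x // mx_subst_y //.
  rewrite !exprZn -scalerAl -scalerAr scalerA -exprD subnK //.
  by rewrite exprVn.
by rewrite macwilliams -natrX mulr_natl -scaler_nat scalerA mulrC.
Qed.

(** The transform exchanges the two summands. *)
Lemma tilde_weight_enum_invariant C :
  sigma_invariant p (tilde_weight_enum K C).
Proof.
rewrite /sigma_invariant /tilde_weight_enum card_Fp //.
set r := _ / _; set W := weight_enum K C; set W' := weight_enum K _.
have WE : mx_subst W (sigma K p) = r *: W' by apply: mx_subst_weight_enum.
have W'E : mx_subst (r *: W') (sigma K p) = W.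
  by rewrite -WE sigma_involutive ?prime_gt0.
rewrite [LHS]comp_mpolyZ comp_mpolyD; congr (_ *: _).
by rewrite [RHS]addrC; congr (_ + _).
Qed.

End PrimeFieldCodes.

(** * Weight distribution of a cyclic code *)

Section WeightDistribution.
Variables (p : nat) (n : nat).
Hypothesis p_pr : prime p.
Local Notation F := 'F_p.

Lemma enumerator_equiv (A : idomainType) (C D : {vspace 'rV[F]_n}) (x y : A) :
  code_equiv C D -> enumerator C x y = enumerator D x y.
Proof.
move=> [s [d [d0 CD]]]; pose f (c : 'rV[F]_n) := \row_i (d i * c 0 (s i)).
have f_inj : injective f.
  move=> c c' /rowP ff'; apply/rowP => i; move: (ff' ((s^-1)%g i)); rewrite !mxE permKV.
  exact: mulfI.
rewrite /enumerator [RHS](reindex_inj f_inj) /=.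
apply: eq_big => [c|c _]; first by rewrite CD.
suff -> : wt (f c) = wt c by [].
rewrite /wt -[RHS](card_imset _ (@perm_inj _ (s^-1)%g)); apply: eq_card => i.
apply/idP/imsetP => [|[j]]; rewrite !inE ?mxE mulf_eq0 negb_or d0 /=.
  by exists (s i); rewrite ?inE // permK.
by move=> cj ->; rewrite permKV.
Qed.

(** All products of [g] by polynomials of size at most [k], by the recursion
    (a + X b) g = a g + X (b g). *)
Fixpoint multiples (g : {poly F}) (k : nat) : seq {poly F} :=
  if k is k'.+1 then
    [seq a *: g + 'X * w | a <- enum F, w <- multiples g k'] else [:: 0].

Lemma multiplesP (g : {poly F}) k (w : {poly F}) :
  reflect (exists2 a : {poly F}, (size a <= k)%N & w = a * g) (w \in multiples g k).
Proof.
elim: k w => [|k IH] w /=.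
  rewrite inE; apply: (iffP eqP) => [->|[a]]; first by exists 0; rewrite ?size_poly0 ?mul0r.
  by rewrite size_poly_leq0 => /eqP -> ->; rewrite mul0r.
apply: (iffP allpairsP) => [[[a v] /= [_ /IH[b sb ->] ->]]|[a]].
  exists (b * 'X + a%:P); last by rewrite mulrDl mul_polyC addrC mulrA [_ * b]mulrC.
  by rewrite -cons_poly_def size_cons_poly; case: ifP.
elim/poly_ind: a => [_ ->|b a _].
  exists (0, 0); rewrite mem_enum scale0r mulr0 mul0r addr0; split=> //.
  by apply/IH; exists 0; rewrite ?size_poly0 ?mul0r.
rewrite -cons_poly_def size_cons_poly => sb ->.
exists (a, b * g); split; rewrite ?mem_enum //=; last first.
  by rewrite cons_poly_def mulrDl mul_polyC addrC mulrA ['X * b]mulrC.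
apply/IH; exists b => //; move: sb; case: ifP => // /andP[/nilP].
by move=> b0 _ _; rewrite (_ : size b = 0%N) // b0.
Qed.

(** The constant coefficient of a g + X w is a times the one of g; so it
    determines a, and then w. *)
Lemma multiples_uniq (g : {poly F}) k : g`_0 != 0 -> uniq (multiples g k).
Proof.
move=> g0; elim: k => //= k IH; apply: allpairs_uniq => //; first exact: enum_uniq.
move=> [a w] [b v] _ _ /= E.
have ab : a = b.
  move/(congr1 (fun h : {poly F} => h`_0)): E; rewrite !coefE /= !addr0.
  exact: mulIf.
congr (_, _) => //; move: E; rewrite ab => /addrI.
by apply: mulfI; rewrite polyX_eq0.
Qed.

Lemma mem_generated_code k (g : {poly F}) (c : 'rV[F]_n) :
  (k + size g <= n.+1)%N ->
  (c \in generated_code n k g) = (rVpoly c \in multiples g k).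
Proof.
move=> sz.
have rowK (i : 'I_k) : rVpoly (poly_rV ('X^i * g) : 'rV[F]_n) = 'X^i * g.
  apply: poly_rV_K; apply: leq_trans (size_polyMleq _ _) _.
  by rewrite size_polyXn /= -ltnS (leq_trans _ sz) // -addSn leq_add2r.
have nthE (i : 'I_k) :
    [seq (poly_rV ('X^j * g) : 'rV[F]_n) | j <- iota 0 k]`_i = poly_rV ('X^i * g).
  by rewrite (nth_map 0%N) ?size_iota // nth_iota.
apply/idP/multiplesP => [|[a sa ca]].
  rewrite /generated_code; set X := map _ _.
  have sX : size X == k by rewrite size_map size_iota.
  rewrite -[X]/(tval (Tuple sX)) => /coord_span ->.
  exists (\poly_(i < k) (if insub i is Some j then coord (Tuple sX) j c else 0)).
    exact: size_poly.
  rewrite poly_def mulr_suml linear_sum; apply: eq_bigr => i _ /=.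
  by rewrite linearZ /= nthE rowK valK -scalerAl.
rewrite -(rVpolyK c) ca -[a](coefK a) poly_def mulr_suml linear_sum.
apply: memv_suml => i _; rewrite -scalerAl linearZ rpredZ //.
apply: memv_span; apply/mapP; exists (i : nat) => //.
by rewrite mem_iota /= (leq_trans (ltn_ord i)).
Qed.

(** Words with natural number entries stand for vectors over the prime field.
    Unlike elements of ['F_p] they carry no proofs, so that the codewords can
    be listed by computation. *)
Definition word_poly (s : seq nat) : {poly F} := Poly [seq a%:R | a <- s].

Definition word_weight (s : seq nat) : nat := count (fun a => ~~ (p %| a)%N) s.

Fixpoint word_add (s t : seq nat) : seq nat :=
  match s, t with
  | a :: s', b :: t' => (a + b)%N :: word_add s' t'
  | [::], _ => t
  | _, [::] => s
  end.

(** The recursion of [multiples] on words.  The entries stay small enough to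
    be left unreduced: only [word_weight] looks at them modulo [p]. *)
Fixpoint words (g : seq nat) (k : nat) : seq (seq nat) :=
  if k is k'.+1 then
    [seq word_add [seq (a * b)%N | b <- g] (0%N :: w) | a <- iota 0 p, w <- words g k']
  else [:: [::]].

Lemma word_poly_cons a s : word_poly (a :: s) = word_poly s * 'X + a%:R%:P.
Proof. by rewrite /word_poly /= cons_poly_def. Qed.

Lemma word_poly_add s t : word_poly (word_add s t) = word_poly s + word_poly t.
Proof.
elim: s t => [|a s IH] [|b t]; rewrite /= ?[word_poly [::]]/word_poly /= ?addr0 ?add0r //.
by rewrite !word_poly_cons IH natrD polyCD; ring.
Qed.

Lemma word_poly_scale a s :
  word_poly [seq (a * b)%N | b <- s] = a%:R *: word_poly s.
Proof.
elim: s => [|b s IH]; first by rewrite /word_poly scaler0.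
by rewrite /= !word_poly_cons IH natrM polyCM -!mul_polyC; ring.
Qed.

Lemma perm_enum_Fp : perm_eq (enum F) [seq a%:R | a <- iota 0 p].
Proof.
apply: uniq_perm; rewrite ?enum_uniq //.
  rewrite map_inj_in_uniq ?iota_uniq // => a b.
  rewrite !mem_iota /= => ap bp /(congr1 (@nat_of_ord _)).
  by rewrite !val_Fp_nat // !modn_small.
move=> a; rewrite mem_enum; apply/esym/mapP; exists (a : nat); last by rewrite natr_Zp.
by rewrite mem_iota /= -{2}(Fp_cast p_pr).
Qed.

Lemma sum_multiples (V : nmodType) (h : {poly F} -> V) (g : seq nat) k :
  \sum_(w <- multiples (word_poly g) k) h w = \sum_(s <- words g k) h (word_poly s).
Proof.
elim: k h => [|k IH] h /=; first by rewrite !big_seq1 /word_poly.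
rewrite !big_allpairs_dep /= (perm_big _ perm_enum_Fp) big_map /=.
apply: eq_bigr => a _; rewrite IH; apply: eq_bigr => w _.
by rewrite word_poly_add word_poly_scale word_poly_cons addr0 [_ * 'X]mulrC.
Qed.

Lemma wt_word (s : seq nat) :
  (size s <= n)%N -> wt (poly_rV (word_poly s) : 'rV[F]_n) = word_weight s.
Proof.
move=> sn; rewrite /wt cardsE -sum1_card.
rewrite (eq_bigl (fun i : 'I_n => ~~ (p %| nth 0%N s i)%N)) => [|i]; last first.
  rewrite unfold_in mxE coef_Poly.
  have [si|si] := ltnP i (size s).
    by rewrite (nth_map 0%N) // -val_eqE /= val_Fp_nat.
  by rewrite !nth_default ?size_map // eqxx dvdn0.
rewrite -(big_mkord (fun i => ~~ (p %| nth 0%N s i)%N) (fun=> 1%N)).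
rewrite (big_cat_nat (leq0n _) sn) /= [X in (_ + X)%N]big1_seq ?addn0; last first.
  move=> i /andP[]; rewrite mem_index_iota => + /andP[si _].
  by rewrite nth_default // dvdn0.
by rewrite -[RHS]sum1_count [in RHS](big_nth 0%N).
Qed.

Definition weight_distribution (g : seq nat) (k : nat) : seq nat :=
  let ws := [seq word_weight s | s <- words g k] in
  [seq count_mem i ws | i <- iota 0 n.+1].

End WeightDistribution.

Section GeneratedCodes.
Variables (p n k : nat) (g : seq nat).
Hypotheses (p_pr : prime p) (g0 : ~~ (p %| nth 0 g 0)%N).
Hypothesis gk : (k + size g <= n.+1)%N.
Local Notation F := 'F_p.
Local Notation D := (generated_code n k (word_poly p g)).

Let word_poly0 : (word_poly p g)`_0 != 0.
Proof.
have g_gt0 : (0 < size g)%N by case: (g) g0; rewrite ?dvdn0.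
by rewrite coef_Poly (nth_map 0%N) // -val_eqE /= val_Fp_nat.
Qed.

Let size_multiples w : w \in multiples (word_poly p g) k -> (size w <= n)%N.
Proof.
move=> /multiplesP[a sa ->].
have sg : (size (word_poly p g) <= size g)%N.
  by rewrite (leq_trans (size_Poly _)) ?size_map.
apply: leq_trans (size_polyMleq _ _) _; rewrite -subn1 leq_subLR add1n.
exact: leq_trans (leq_add sa sg) gk.
Qed.

Lemma size_words s : s \in words p g k -> (size s <= n)%N.
Proof.
have g_gt0 : (0 < size g)%N by case: (g) g0; rewrite ?dvdn0.
have size_add t u : size (word_add t u) = maxn (size t) (size u).
  by elim: t u => [|a t IH] [|b u] //=; rewrite ?maxn0 ?max0n // IH maxnSS.
suff H k' t : t \in words p g k' -> (size t < k' + size g)%N.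
  by move=> /H/leq_trans/(_ gk).
elim: k' t => [|k' IH] t /=; first by rewrite inE => /eqP ->.
move=> /allpairsP[[a w] /= [_ /IH wk ->]]; rewrite size_add size_map /=.
by rewrite gtn_max addSn !ltnS wk andbT leq_addl.
Qed.

Lemma perm_generated_code :
  perm_eq (enum (mem D)) [seq poly_rV w | w <- multiples (word_poly p g) k].
Proof.
apply: uniq_perm; first exact: enum_uniq.
  rewrite map_inj_in_uniq ?multiples_uniq // => v w /size_multiples sv /size_multiples sw.
  by move=> /(congr1 rVpoly); rewrite !poly_rV_K.
have sg : (k + size (word_poly p g) <= n.+1)%N.
  by apply: leq_trans gk; rewrite leq_add2l (leq_trans (size_Poly _)) ?size_map.
move=> c; rewrite mem_enum mem_generated_code //; apply/idP/mapP => [cg|[w wg ->]].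
  by exists (rVpoly c); rewrite ?rVpolyK.
by rewrite poly_rV_K // size_multiples.
Qed.

Lemma sum_by_value (V : nmodType) (f : nat -> V) (ws : seq nat) :
  all (fun a => a <= n)%N ws ->
  \sum_(a <- ws) f a = \sum_(i < n.+1) f i *+ count_mem (i : nat) ws.
Proof.
elim: ws => [_|a ws IH /= /andP[an /IH]].
  by rewrite big_nil big1 // => i _; rewrite mulr0n.
rewrite big_cons => ->; under [RHS]eq_bigr do rewrite mulrnDr.
rewrite big_split /=; congr (_ + _).
rewrite (bigD1 (Ordinal (an : a < n.+1)%N)) //= eqxx mulr1n.
by rewrite big1 ?addr0 // => i; rewrite -val_eqE /= eq_sym => /negPf ->.
Qed.

Lemma enumerator_generated (A : idomainType) (x y : A) :
  enumerator D x y =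
  \sum_(i < n.+1) (x ^+ (n - i) * y ^+ i) *+ nth 0%N (weight_distribution p n g k) i.
Proof.
pose f i := x ^+ (n - i) * y ^+ i.
pose ws := [seq word_weight p s | s <- words p g k].
transitivity (\sum_(a <- ws) f a).
  rewrite /enumerator [RHS]big_map -big_enum /= (perm_big _ perm_generated_code) big_map /=.
  rewrite (sum_multiples p_pr (fun w => f (wt (poly_rV w : 'rV[F]_n)))).
  by rewrite !big_seq; apply: eq_bigr => s /size_words sn; rewrite wt_word.
rewrite sum_by_value; last first.
  apply/allP => _ /mapP[s /size_words sn ->].
  exact: leq_trans (count_size _ _) sn.
apply: eq_bigr => i _; congr (_ *+ _).
by rewrite (nth_map 0%N) ?size_iota // nth_iota.
Qed.

Lemma dim_generated : \dim D = k.
Proof.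
have sz j : size (multiples (word_poly p g) j) = (p ^ j)%N.
  by elim: j => [|j IH] /=; rewrite ?size_allpairs ?IH -?cardE ?card_Fp ?expnS.
have /eqP : (p ^ \dim D = p ^ k)%N.
  by rewrite -{1}(card_Fp p_pr) -card_vspace cardE (perm_size perm_generated_code) size_map sz.
by rewrite eqn_exp2l ?prime_gt1 // => /eqP.
Qed.

(** The value at (1, 1) of its enumerator is the cardinality of a code. *)
Lemma dim_equiv (C C' : {vspace 'rV[F]_n}) : code_equiv C C' -> \dim C = \dim C'.
Proof.
move=> CC'; have := enumerator_equiv (1 : int) 1 CC'; rewrite /enumerator.
do 2![under eq_bigr do rewrite !expr1n mulr1; rewrite sumr_const].
rewrite !card_vspace card_Fp // => /eqP; rewrite eqr_nat => /eqP/eqP.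
by rewrite eqn_exp2l ?prime_gt1 // => /eqP.
Qed.

End GeneratedCodes.

(** * Zeta polynomials and binomial moments *)

Definition binary_form (K : nzRingType) (n : nat) (c : nat -> K) : {mpoly K[2]} :=
  \sum_(i < n.+1) c i *: (polyx K ^+ (n - i) * polyy K ^+ i).

Section ZetaSeries.
Variables (K : numClosedFieldType) (q n : nat).
Local Notation x := (polyx K).
Local Notation y := (polyy K).
Local Notation MP := {mpoly K[2]}.
Implicit Types P Q : {poly K}.

(** The expansion of P(T) / ((1 - T)(1 - q T)). *)
Definition zeta_coef (P : {poly K}) : nat -> K :=
  series_mul (series_of_poly P) (series_mul (series_geom 1) (series_geom q%:R)).

(** The forms y^(n-k) (x - y)^k arise because
    y (1 - T) + x T = y + (x - y) T. *)
Let basis k : MP := (y ^+ (n - k) * (x - y) ^+ k) *+ 'C(n, k).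

Let coef_expansion k :
  (((y)%:P * (1 - 'X) + (x)%:P * 'X) ^+ n : {poly MP})`_k = basis k.
Proof.
have -> : (y)%:P * (1 - 'X) + (x)%:P * 'X = (y)%:P + (x - y)%:P * 'X :> {poly MP}.
  by rewrite polyCB; ring.
rewrite exprDn coef_sum.
have termE (i : 'I_n.+1) :
    ((y%:P ^+ (n - i) * ((x - y)%:P * 'X) ^+ i) *+ 'C(n, i) : {poly MP})`_k =
    if i == k :> nat then basis k else 0.
  rewrite coefMn exprMn mulrA -!polyC_exp -polyCM coefCM coefXn eq_sym.
  by case: eqP => [->|_]; rewrite ?mulr1 // mulr0 mul0rn.
under eq_bigr do rewrite termE; rewrite -big_mkcond /=.
have [kn|nk] := leqP k n.
  by rewrite (big_pred1 (Ordinal (kn : k < n.+1)%N)).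
rewrite big1 => [|i /eqP ik]; last by have := ltn_ord i; rewrite ik ltnS leqNgt nk.
by rewrite /basis bin_small ?mulr0n.
Qed.

Lemma zeta_seriesE (P : {poly K}) m :
  zeta_series q n P m = \sum_(i < m.+1) zeta_coef P i *: basis (m - i).
Proof.
have series_mulE (s t : nat -> K) (s' t' : nat -> MP) j :
    (forall i, s' i = (s i)%:MP) -> (forall i, t' i = (t i)%:MP) ->
    series_mul s' t' j = (series_mul s t j)%:MP.
  move=> ss tt; rewrite [RHS]raddf_sum; apply: eq_bigr => i _ /=.
  by rewrite ss tt mpolyCM.
rewrite {1}/zeta_series {1}/series_mul; apply: eq_bigr => i _.
rewrite /series_of_poly coef_expansion -mul_mpolyC; congr (_ * _).
apply: (series_mulE) => [j|j]; first by rewrite coef_map_id0 ?mpolyC0.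
by apply: series_mulE => l; rewrite /series_geom rmorphXn /= ?mpolyC1 ?rmorph_nat.
Qed.

Lemma zeta_coefD P Q i : zeta_coef (P + Q) i = zeta_coef P i + zeta_coef Q i.
Proof.
rewrite /zeta_coef /series_mul -big_split; apply: eq_bigr => j _.
by rewrite /= /series_of_poly coefD mulrDl.
Qed.

Lemma zeta_coefZ a P i : zeta_coef (a *: P) i = a * zeta_coef P i.
Proof.
rewrite /zeta_coef /series_mul mulr_sumr; apply: eq_bigr => j _.
by rewrite /= /series_of_poly coefZ mulrA.
Qed.

Lemma zeta_seriesD P Q m :
  zeta_series q n (P + Q) m = zeta_series q n P m + zeta_series q n Q m.
Proof.
rewrite !zeta_seriesE -big_split; apply: eq_bigr => i _.
by rewrite zeta_coefD scalerDl.
Qed.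

Lemma zeta_seriesZ a P m : zeta_series q n (a *: P) m = a *: zeta_series q n P m.
Proof.
rewrite !zeta_seriesE scaler_sumr; apply: eq_bigr => i _.
by rewrite zeta_coefZ scalerA.
Qed.

Lemma zeta_seriesX P m : zeta_series q n ('X * P) m.+1 = zeta_series q n P m.
Proof.
rewrite !zeta_seriesE big_ord_recl.
have -> : zeta_coef ('X * P) (@ord0 m.+1) = 0.
  by rewrite /zeta_coef /series_mul big_ord1 /series_of_poly coefXM mul0r.
rewrite scale0r add0r; apply: eq_bigr => i _; congr (_ *: _).
rewrite /zeta_coef {1}/series_mul big_ord_recl /series_of_poly coefXM mul0r add0r.
by apply: eq_bigr => j _; rewrite coefXM.
Qed.

(** At x = X + 1 and y = 1 the forms y^(n-k) (x - y)^k become distinct powers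
    of X, and their binomial coefficients do not vanish; so the coefficients
    of P(T) / ((1 - T)(1 - q T)) up to degree [m] can be recovered, and [P]
    from them. *)
Lemma zeta_series_inj P Q m : (m <= n)%N -> (size P <= m.+1)%N -> (size Q <= m.+1)%N ->
  zeta_series q n P m = zeta_series q n Q m -> P = Q.
Proof.
move=> mn sP sQ PQ; apply/eqP; rewrite -subr_eq0; apply/eqP.
set D := P - Q.
have sD : (size D <= m.+1)%N.
  by rewrite (leq_trans (size_polyD _ _)) // size_polyN geq_max sP.
have : zeta_series q n D m = 0.
  by rewrite /D -scaleN1r zeta_seriesD zeta_seriesZ PQ scaleN1r subrr.
rewrite zeta_seriesE => /(congr1 (mmap (@polyC K) (fun i => if i == ord0 then 'X + 1 else 1))).
rewrite rmorph0 raddf_sum /= => D0.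
have zc0 i : (i <= m)%N -> zeta_coef D i = 0.
  move=> im; move/(congr1 (fun p : {poly K} => p`_(m - i))): D0.
  rewrite coef0 coef_sum (bigD1 (Ordinal (im : i < m.+1)%N)) //= big1 => [|j ji].
    rewrite mmapZ rmorphMn rmorphM !rmorphXn rmorphB /= !mmapX !mmap1U /= expr1n mul1r addrK.
    rewrite addr0 coefCM coefMn coefXn eqxx => /eqP.
    by rewrite mulf_eq0 pnatr_eq0 -leqn0 leqNgt bin_gt0 (leq_trans (leq_subr _ _) mn) orbF => /eqP.
  rewrite mmapZ rmorphMn rmorphM !rmorphXn rmorphB /= !mmapX !mmap1U /= expr1n mul1r addrK.
  rewrite coefCM coefMn coefXn; case: eqP => [E|]; last by rewrite mul0rn mulr0.
  case/eqP: ji; apply: val_inj => /=.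
  by rewrite -[LHS](subKn (ltn_ord j : j <= m)%N) -E subKn.
suff H i : (i <= m)%N -> D`_i = 0.
  apply/polyP => i; rewrite coef0; have [/H//|mi] := leqP i m.
  by rewrite nth_default // (leq_trans sD).
elim/ltn_ind: i => i IH im.
have := zc0 _ im; rewrite /zeta_coef {1}/series_mul big_ord_recr /= subnn big1 ?add0r => [|j _].
  by rewrite /series_mul big_ord1 /series_geom !expr0 !mulr1.
by rewrite /series_of_poly IH ?mul0r // (leq_trans (ltnW (ltn_ord j))).
Qed.

(** Expand x^(n-i) = (y + (x - y))^(n-i). *)
Lemma binomial_moments (a : nat -> K) :
  binary_form n a =
  \sum_(k < n.+1) (\sum_(i < n.+1) a i * 'C(n - i, k)%:R) *: (y ^+ (n - k) * (x - y) ^+ k).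
Proof.
under [RHS]eq_bigr do rewrite scaler_suml.
rewrite exchange_big; apply: eq_bigr => i _ /=.
under eq_bigr do rewrite -scalerA; rewrite -scaler_sumr; congr (_ *: _).
rewrite -{1}[x](subrK y) [x - y + y]addrC exprDn mulr_suml.
have ni : ((n - i).+1 <= n.+1)%N by rewrite ltnS leq_subr.
rewrite (big_ord_widen _ (fun k => y ^+ (n - i - k) * (x - y) ^+ k *+ 'C(n - i, k) * y ^+ i) ni).
rewrite big_mkcond; apply: eq_bigr => k _ /=.
case: ltnP => [|nik]; last by rewrite bin_small ?scale0r.
rewrite ltnS => kni; rewrite mulrnAl scaler_nat; congr (_ *+ _).
rewrite mulrAC -exprD; congr (y ^+ _ * _).
have ik : (k + i <= n)%N by rewrite addnC -leq_subRL // -ltnS.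
by rewrite subnAC subnK // leq_subRL // (leq_trans (leq_addr _ _) ik).
Qed.

End ZetaSeries.

Section BinaryMoments.

(** A row of Pascal's triangle is computed at once: the recursion that defines
    binomial coefficients takes exponential time. *)
Fixpoint binomial_row (n : nat) : seq N :=
  if n is n'.+1 then
    let r := binomial_row n' in
    mkseq (fun k => (if k is k'.+1 then nth 0 r k' else 0) + nth 0 r k)%num n.+1
  else [:: 1%num].

Definition binomialN (n k : nat) : N := nth 0%num (binomial_row n) k.

Fixpoint geomN (q : N) (l : nat) : N :=
  if l is l'.+1 then (1 + q * geomN q l')%num else 1%num.

Definition sumN (m : nat) (f : nat -> N) : N :=
  foldr (fun i => N.add (f i)) 0%num (iota 0 m).

Definition momentN (a : seq N) (n k : nat) : N :=
  sumN n.+1 (fun i => nth 0 a i * binomialN (n - i) k)%num.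

Definition zeta_coefN (q : N) (b : seq N) (j : nat) : N :=
  sumN j.+1 (fun i => nth 0 b i * geomN q (j - i))%num.

(** With [d], [q] and the entries of [a] and [b] in binary, the equations
    d M_k = (q - 1) C(n, k) s_(m-k), where M_k is the k-th binomial moment of
    [a] and s_j the coefficient of degree j of B(T) / ((1 - T)(1 - q T)), with
    s_j = 0 for j < 0, for the polynomial B with coefficients [b].  The term
    [z] is added to both sides because subtraction in [N] is truncated. *)
Definition moments_match (q d : N) (a b : seq N) (n m : nat) : bool :=
  all (fun k =>
         let z := (if (k <= m)%N then binomialN n k * zeta_coefN q b (m - k) else 0)%num in
         (d * momentN a n k + z == q * z)%num)
    (iota 0 n.+1).

Variable K : numClosedFieldType.
Local Notation x := (polyx K).
Local Notation y := (polyy K).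

Definition castN (z : N) : K := (nat_of_bin z)%:R.

Lemma castND a b : castN (a + b)%num = castN a + castN b.
Proof. by rewrite /castN (rmorphD nat_of_bin) natrD. Qed.

Lemma castNM a b : castN (a * b)%num = castN a * castN b.
Proof. by rewrite /castN (rmorphM nat_of_bin) natrM. Qed.

Lemma castN_binomial n k : castN (binomialN n k) = 'C(n, k)%:R.
Proof.
have size_row m : size (binomial_row m) = m.+1 by case: m => // m; rewrite size_mkseq.
rewrite /binomialN; elim: n k => [|n IH] k; first by case: k => [|[|k]].
have [kn|nk] := ltnP k n.+2; last by rewrite nth_default ?size_row ?bin_small.
rewrite nth_mkseq // castND IH; case: k kn => [|k] kn; rewrite ?bin0 ?add0r //.
by rewrite IH binS natrD addrC.
Qed.

Lemma castN_geom q l : castN (geomN q l) = \sum_(i < l.+1) castN q ^+ i.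
Proof.
elim: l => [|l IH]; first by rewrite big_ord1.
rewrite big_ord_recl -[geomN q l.+1]/(1 + q * geomN q l)%num castND castNM IH mulr_sumr.
by congr (_ + _); apply: eq_bigr => i _; rewrite exprS.
Qed.

Lemma castN_sum m f : castN (sumN m f) = \sum_(i < m) castN (f i).
Proof.
rewrite -(big_mkord xpredT (castN \o f)) /sumN /index_iota subn0 unlock.
by elim: (iota 0 m) => //= i s <-; rewrite castND.
Qed.

(** Compare the coefficients of both sides in the basis y^(n-k) (x - y)^k. *)
Lemma zeta_series_of_moments (q : nat) (qN d : N) (a b : seq N) n m :
  (1 < q)%N -> nat_of_bin qN = q -> castN d != 0 ->
  (m <= n)%N -> moments_match qN d a b n m ->
  zeta_series q n ((castN d)^-1 *: Poly (map castN b)) m =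
  (q%:R - 1)^-1 *: binary_form n (fun i => castN (nth 0%num a i)).
Proof.
move=> q1 qNE d0 mn /allP match_ab; set P := _ *: _.
have qK : castN qN = q%:R by rewrite /castN qNE.
have zcE j : castN (zeta_coefN qN b j) = castN d * zeta_coef q P j.
  rewrite zeta_coefZ mulVKf // castN_sum; apply: eq_bigr => i _.
  rewrite /series_of_poly coef_Poly castNM castN_geom qK; congr (_ * _).
    have [ib|bi] := ltnP i (size b); first by rewrite (nth_map 0%num).
    by rewrite !nth_default ?size_map.
  rewrite /series_mul /series_geom (reindex_inj rev_ord_inj); apply: eq_bigr => l _ /=.
  by rewrite expr1n mul1r subSS.
have momE k : (k <= n)%N ->
    \sum_(i < n.+1) castN (nth 0%num a i) * 'C(n - i, k)%:R =
    (q%:R - 1) * (if (k <= m)%N then 'C(n, k)%:R * zeta_coef q P (m - k) else 0).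
  move=> kn; have := match_ab k; rewrite mem_iota => /(_ kn)/eqP/(congr1 castN).
  rewrite castND !castNM qK => /eqP; rewrite eq_sym -subr_eq => /eqP momE.
  apply: (mulfI d0); have <- : castN (momentN a n k) =
      \sum_(i < n.+1) castN (nth 0%num a i) * 'C(n - i, k)%:R.
    by rewrite castN_sum; apply: eq_bigr => i _; rewrite castNM castN_binomial.
  rewrite -momE; case: ifP => _; last by rewrite /castN; ring.
  by rewrite castNM castN_binomial zcE; ring.
rewrite (binomial_moments n (fun i => castN (nth 0%num a i))) zeta_seriesE.
under [X in _ = _ *: X]eq_bigr => k _ do rewrite momE -1?ltnS // -scalerA.
rewrite -scaler_sumr scalerA mulVf ?scale1r; last first.
  by rewrite subr_eq0 pnatr_eq1 neq_ltn q1 orbT.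
rewrite (reindex_inj rev_ord_inj) /=.
rewrite (big_ord_widen _ (fun k => zeta_coef q P (m - k) *:
   ((y ^+ (n - (m - (m - k))) * (x - y) ^+ (m - (m - k))) *+ 'C(n, m - (m - k))))
   (mn : m.+1 <= n.+1)%N).
rewrite big_mkcond; apply: eq_bigr => k _ /=; rewrite ltnS.
case: leqP => km; last by rewrite scale0r.
by rewrite subKn // -scaler_nat scalerA mulrC.
Qed.
End BinaryMoments.

Section RiemannHypothesis.
Variables (K : numClosedFieldType) (q : nat) (qN dN : N) (n d m : nat) (a a' b : seq N).
Hypotheses (q1 : (1 < q)%N) (qNE : nat_of_bin qN = q) (dN0 : castN K dN != 0).
Hypotheses (d0 : (0 < d)%N) (nE : n = (d + m.+1)%N).
Hypotheses (a_d : all (pred1 0%num) (take d a)) (a'_d : all (pred1 0%num) (take d.+1 a')).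
Hypothesis ad0 : nth 0%num a d != 0%num.
Hypotheses (match_a : moments_match qN dN a b n m.+1).
Hypotheses (match_a' : moments_match qN dN a' b n m).
Hypothesis size_b : (size b <= m.+1)%N.
Local Notation x := (polyx K).
Local Notation y := (polyy K).
Local Notation r := (sqrtC (q%:R : K)).

Let P0 : {poly K} := (castN K dN)^-1 *: Poly (map (castN K) b).
Hypothesis P0_roots : forall z : K, root P0 z -> `|z| = r^-1.

(** By linearity and since T P0 yields at degree [m.+1] what P0 yields at
    degree [m], the zeta polynomial is (1 + r T) P0 / (1 + r); the root -1/r
    of the first factor has the required absolute value. *)
Lemma riemann_hypothesis_of_moments :
  riemann_hypothesis q ((1 + r)^-1 *:
    ((x ^+ n + binary_form n (fun i => castN K (nth 0%num a i))) +
     r *: (x ^+ n + binary_form n (fun i => castN K (nth 0%num a' i))))).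
Proof.
have r_gt0 : 0 < r by rewrite sqrtC_gt0 ltr0n ltnW.
have r1 : 1 + r != 0 by rewrite gt_eqF ?addr_gt0.
have dn : (d <= n)%N by rewrite nE leq_addr.
have mE : (n - d)%N = m.+1 by rewrite nE addKn.
have nth_take_eq0 (s : seq N) e i :
    all (pred1 0%num) (take e s) -> (i < e)%N -> nth 0%num s i = 0%num.
  move=> /(all_nthP 0%num) se ie; have [si|si] := ltnP i (size s); last by rewrite nth_default.
  have := se i; rewrite size_take_min leq_min ie => /(_ si); by rewrite nth_take // => /eqP.
pose c i := (1 + r)^-1 * (castN K (nth 0%num a i) + r * castN K (nth 0%num a' i)).
set W := (X in riemann_hypothesis q X).
have formE : binary_form n c =
    (1 + r)^-1 *: (binary_form n (fun i => castN K (nth 0%num a i)) +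
                   r *: binary_form n (fun i => castN K (nth 0%num a' i))).
  rewrite /binary_form [in RHS]scaler_sumr -big_split scaler_sumr; apply: eq_bigr => i _.
  by rewrite /= scalerA -scalerDl scalerA.
have WE : W - x ^+ n = binary_form n c.
  rewrite formE; apply: (scalerI r1); rewrite scalerBr !scalerA mulfV // !scale1r scalerDl scale1r.
  by rewrite scalerDr addrACA [X in X - _]addrC addrK.
pose P := (1 + r)^-1 *: (P0 + r *: ('X * P0)).
have zeta_P : is_zeta_poly q n d W P.
  split.
    rewrite mE (leq_trans (size_scale_leq _ _)) // (leq_trans (size_polyD _ _)) // geq_max.
    have sP0 : (size P0 <= m.+1)%N.
      by rewrite (leq_trans (size_scale_leq _ _)) // (leq_trans (size_Poly _)) ?size_map.
    rewrite (leq_trans sP0) //= (leq_trans (size_scale_leq _ _)) //.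
    by rewrite (leq_trans (size_polyMleq _ _)) // size_polyX.
  rewrite mE WE zeta_seriesZ zeta_seriesD (zeta_seriesZ q n r) zeta_seriesX.
  rewrite (zeta_series_of_moments q1 qNE _ _ match_a) //; last by rewrite nE leq_addl.
  rewrite (zeta_series_of_moments q1 qNE _ _ match_a') //; last first.
    by rewrite nE (leq_trans (leqnSn m)) ?leq_addl.
  rewrite scalerA [r * _]mulrC -scalerA -scalerDr !scalerA [_ * (q%:R - 1)^-1]mulrC -scalerA.
  by rewrite formE.
exists n, d; split.
- split; first by rewrite d0.
  exists c; split.
    have a0 : 0 < castN K (nth 0%num a d).
      rewrite ltr0n lt0n; apply: contra ad0 => /eqP ad.
      by apply/eqP; apply: (can_inj nat_of_binK).
    by rewrite mulf_neq0 ?invr_eq0 // gt_eqF // ltr_wpDr // mulr_ge0 ?ler0n // ltW.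
  apply/eqP; rewrite addrC -subr_eq WE; apply/eqP.
  rewrite /binary_form -(big_mkord xpredT (fun i => c i *: (x ^+ (n - i) * y ^+ i))).
  rewrite (big_cat_nat (leq0n d)) /=; last by rewrite ltnW.
  rewrite big1_seq ?add0r // => i /=; rewrite mem_index_iota => /= id_.
  rewrite /c (nth_take_eq0 a d) // (nth_take_eq0 a' d.+1) ?ltnS ?(ltnW id_) //.
  by rewrite /castN mulr0 addr0 mulr0 scale0r.
- exists P; split=> // Q [sQ zQ]; case: zeta_P => sP zP.
  by apply: (zeta_series_inj (q := q) (leq_subr d n) sP sQ); rewrite zP zQ.
- move=> Q [sQ zQ] z; have -> : Q = P.
    case: zeta_P => sP zP.
    by apply: (zeta_series_inj (q := q) (leq_subr d n) sQ sP); rewrite zP zQ.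
  have -> : P = (1 + r)^-1 *: ((1 + r *: 'X) * P0).
    by rewrite mulrDl mul1r -scalerAl.
  rewrite rootZ ?invr_eq0 // rootM => /orP[|/P0_roots //].
  rewrite rootE !hornerE addrC addr_eq0 => /eqP rz.
  have -> : z = - r^-1 by rewrite -mulN1r -rz mulrAC mulfV ?mul1r // gt_eqF.
  by rewrite normrN gtr0_norm // invr_gt0.
Qed.
End RiemannHypothesis.

(** * Absolute values of the roots *)

Section CriticalCircle.
Variables (K : numClosedFieldType) (q : nat).
Hypothesis q0 : (0 < q)%N.

(** Subtracting its conjugate from the equation gives
    (z - z^* ) (q |z|^2 - 1) = 0.  A real [z] is excluded by the sign of the
    discriminant u^2 - 4 q of q Z^2 - u Z + 1. *)
Lemma norm_of_real_sum (z u : K) :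
  z != 0 -> u \is Num.real -> u ^+ 2 < 4 * q%:R ->
  q%:R * z + z^-1 = u -> `|z| = (sqrtC q%:R)^-1.
Proof.
move=> z0 u_real u_small zu.
have qK : q%:R != 0 :> K by rewrite pnatr_eq0 -lt0n.
have zc0 : z^* != 0 by rewrite conjC_eq0.
have zcu : q%:R * z^* + z^*^-1 = u.
  by rewrite -[RHS](CrealP u_real) -zu rmorphD rmorphM /= fmorphV conjC_nat.
have : (z - z^*) * (q%:R * (z * z^*) - 1) = 0.
  transitivity (z * z^* * ((q%:R * z + z^-1) - (q%:R * z^* + z^*^-1))).
    by field; rewrite z0 zc0.
  by rewrite zu zcu subrr mulr0.
move=> /eqP; rewrite mulf_eq0 !subr_eq0 => /orP[/eqP zr|/eqP qzz].
  have z_real : z \is Num.real by apply/CrealP.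
  have : 0 <= (2 * (q%:R * z) - u) ^+ 2.
    by rewrite real_exprn_even_ge0 // rpredB ?rpredM ?rpred_nat.
  have -> : (2 * (q%:R * z) - u) ^+ 2 = u ^+ 2 - 4 * q%:R by rewrite -zu; field.
  by rewrite subr_ge0 lt_geF.
apply/eqP; rewrite -(@eqrXn2 _ 2) ?invr_ge0 ?sqrtC_ge0 ?ler0n //.
by rewrite exprVn sqrtCK normCK -[X in X == _](mulKf qK) qzz mulr1.
Qed.
End CriticalCircle.

(** The product of this polynomial at 2 T + 1/T by T^5 is the polynomial
    of degree 10 with coefficients [golay23_zeta] below. *)
Definition golay_quintic (A : nzRingType) : {poly A} :=
  Poly [:: - 36; - 118; 0; 130; 78; 13].

Lemma horner_golay_quintic (A : comNzRingType) (v : A) :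
  (golay_quintic A).[v] = 13 * v ^+ 5 + 78 * v ^+ 4 + 130 * v ^+ 3 - 118 * v - 36.
Proof. by rewrite horner_Poly /=; ring. Qed.

Lemma map_golay_quintic (A B : nzRingType) (f : {rmorphism A -> B}) :
  map_poly f (golay_quintic A) = golay_quintic B.
Proof.
have listE :
    [:: - 36; - 118; 0; 130; 78; 13] = map f [:: - 36; - 118; 0; 130; 78; 13].
  by rewrite /= !rmorphN rmorph0 !rmorph_nat.
apply/polyP => i; rewrite coef_map !coef_Poly listE.
have [is6|] := ltnP i 6; first by rewrite (nth_map 0).
by move=> i6; rewrite !nth_default ?size_map ?raddf0.
Qed.

(** Sign changes at -14/5, -5/2, -2, -1, 0 and 1 give five real roots, which
    leaves no room for another complex root.  As 14/5 < sqrt 8, they are small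
    enough for [norm_of_real_sum]. *)
Lemma golay_quintic_complex_root (R : realType) (u : R[i]) :
  13 * u ^+ 5 + 78 * u ^+ 4 + 130 * u ^+ 3 - 118 * u - 36 = 0 ->
  exists2 v : R, u = (v%:C)%C & v ^+ 2 < 8.
Proof.
move=> u_root; pose Q := golay_quintic; have QE := horner_golay_quintic.
have root_between (a b : R) : a <= b -> (Q R).[a] * (Q R).[b] < 0 ->
    exists2 v, a < v < b & root (Q R) v.
  by move=> ab /(poly_ivtoo ab)[v]; rewrite in_itv; exists v.
have [v1 b1 r1] : exists2 v, - 14 / 5 < v < - 5 / 2 & root (Q R) v.
  by apply: root_between; rewrite ?QE; lra.
have [v2 b2 r2] : exists2 v, - 5 / 2 < v < - 2 & root (Q R) v.
  by apply: root_between; rewrite ?QE; lra.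
have [v3 b3 r3] : exists2 v, - 2 < v < - 1 & root (Q R) v.
  by apply: root_between; rewrite ?QE; lra.
have [v4 b4 r4] : exists2 v, - 1 < v < 0 & root (Q R) v.
  by apply: root_between; rewrite ?QE; lra.
have [v5 b5 r5] : exists2 v, 0 < v < 1 & root (Q R) v.
  by apply: root_between; rewrite ?QE; lra.
pose vs := [:: v1; v2; v3; v4; v5].
have sorted_vs : sorted <%O vs by rewrite /=; repeat (apply/andP; split => //); lra.
have /hasP[v] : has (fun v => u == (v%:C)%C) vs.
  apply: contraT => /hasPn u_vs.
  have : (size (u :: map (real_complex R) vs) < size (Q R[i]))%N.
    apply: max_poly_roots.
    - apply/eqP => /(congr1 (fun p : {poly R[i]} => p`_0)).
      by rewrite coef_Poly coef0 /= => /eqP; rewrite oppr_eq0 pnatr_eq0.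
    - have C_root v : root (Q R) v -> root (Q R[i]) (v%:C)%C.
        by rewrite -[Q R[i]](map_golay_quintic (real_complex R)); apply: rmorph_root.
      by rewrite /= !C_root // rootE QE u_root eqxx.
    - rewrite cons_uniq map_inj_uniq; last by move=> ? ? [].
      rewrite (sorted_uniq lt_trans ltxx sorted_vs) andbT.
      by apply/mapP => -[v /u_vs /eqP].
  by rewrite ltnNge (leq_trans (size_Poly _)).
rewrite !inE => v_vs /eqP uv; exists v => //.
have : - 14 / 5 < v < 1.
  by case/or4P: v_vs => [/eqP->|/eqP->|/eqP->|/orP[]/eqP->]; lra.
by move=> /andP[? ?]; nra.
Qed.

(** * From weight distributions to the Riemann hypothesis *)

(** Zero counts are skipped and exponents are computed along the list, so that
    on explicit lists this unfolds to a short sum for [ring]. *)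
Fixpoint sparse_form (A : comNzRingType) (u v : A) (n i : nat) (s : seq nat) : A :=
  match s with
  | [::] => 0
  | a :: s' =>
    if a == 0%N then sparse_form u v n.-1 i.+1 s'
    else (u ^+ n * v ^+ i) *+ a + sparse_form u v n.-1 i.+1 s'
  end.

Lemma sparse_formE (A : comNzRingType) (u v : A) n s : size s = n.+1 ->
  \sum_(i < n.+1) (u ^+ (n - i) * v ^+ i) *+ nth 0%N s i = sparse_form u v n 0 s.
Proof.
have gen m i : sparse_form u v m i s =
    \sum_(j < size s) (u ^+ (m - j) * v ^+ (i + j)) *+ nth 0%N s j.
  elim: s m i => [|a s IH] m i; first by rewrite big_ord0.
  rewrite big_ord_recl /= subn0 addn0 IH.
  under [in RHS]eq_bigr do rewrite /bump /= add1n addnS -addSn subnS -subn1 subnAC subn1.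
  by case: eqP => // ->; rewrite mulr0n add0r.
by move=> sz; rewrite gen sz.
Qed.

Section NearlySelfDualCodes.
Variables (K : numClosedFieldType) (p n k d m : nat) (A A' : seq nat).
Variables (pN dN : N) (b : seq N).
Variable C : {vspace 'rV['F_p]_n}.
Local Notation x := (polyx K).
Local Notation y := (polyy K).
(* The first entry, which counts the zero word, is replaced by 0: this removes
   the term x^n. *)
Let toN (s : seq nat) : seq N := 0%num :: map bin_of_nat s.
Hypotheses (p_pr : prime p) (pNE : nat_of_bin pN = p) (dN0 : castN K dN != 0).
Hypotheses (nk : n.+1 = k.*2) (dimC : \dim C = k).
Hypotheses (d0 : (0 < d)%N) (nE : n = (d + m.+1)%N).
Hypothesis weights : forall u v : {mpoly K[2]},
  enumerator C u v = \sum_(i < n.+1) (u ^+ (n - i) * v ^+ i) *+ nth 0%N (1%N :: A) i.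
Hypotheses (size_A : size A = n) (size_A' : size A' = n).
Hypothesis transform :
  sparse_form (x + p.-1%:R * y) (x - y) n 0 (1%N :: A) =
  p%:R ^+ k * sparse_form x y n 0 (1%N :: A').
Hypotheses (A_d : all (pred1 0%num) (take d (toN A))).
Hypotheses (A'_d : all (pred1 0%num) (take d.+1 (toN A'))).
Hypothesis Ad0 : nth 0%num (toN A) d != 0%num.
Hypotheses (match_A : moments_match pN dN (toN A) b n m.+1).
Hypotheses (match_A' : moments_match pN dN (toN A') b n m).
Hypothesis size_b : (size b <= m.+1)%N.
Hypothesis roots : forall z : K,
  root ((castN K dN)^-1 *: Poly (map (castN K) b)) z -> `|z| = (sqrtC p%:R)^-1.

Let split_head (s : seq nat) :
  \sum_(i < n.+1) (x ^+ (n - i) * y ^+ i) *+ nth 0%N (1%N :: s) i =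
  x ^+ n + binary_form n (fun i => castN K (nth 0%num (toN s) i)).
Proof.
rewrite /binary_form big_ord_recl [in RHS]big_ord_recl /= {2}/castN /= scale0r add0r.
rewrite subn0 mulr1.
congr (_ + _); apply: eq_bigr => i _; rewrite -scaler_nat; congr (_%:R *: _).
rewrite add0n; have [si|si] := ltnP i (size s); last by rewrite !nth_default ?size_map.
by rewrite (nth_map 0%N) // bin_of_natK.
Qed.

(** As n = 2k - 1, the factor q^(k - n/2) is sqrt q; and the hypothesis
    [transform] says, by the MacWilliams identity, that [A'] gives the weights
    of the dual code. *)
Lemma riemann_hypothesis_of_weights :
  riemann_hypothesis p (tilde_weight_enum K C).
Proof.
have sq0 := sqrt_neq0 K (prime_gt0 p_pr).
have rE : p%:R ^+ \dim C / sqrtC (p%:R : K) ^+ n = sqrtC p%:R.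
  rewrite dimC -[p%:R in X in X / _]sqrtCK -exprM mul2n -nk exprS mulfK //.
  by rewrite expf_neq0.
have W'E : weight_enum K (dual_code C) =
    \sum_(i < n.+1) (x ^+ (n - i) * y ^+ i) *+ nth 0%N (1%N :: A') i.
  have pk0 : p%:R ^+ k != 0 :> {mpoly K[2]}.
    by rewrite expf_neq0 // -(rmorph_nat (@mpolyC 2 K)) mpolyC_eq0 pnatr_eq0 -lt0n prime_gt0.
  apply: (mulfI pk0); rewrite sparse_formE /= ?size_A' // -transform -sparse_formE /= ?size_A //.
  by rewrite -weights macwilliams // dimC natrX.
rewrite /tilde_weight_enum card_Fp // rE W'E.
rewrite [weight_enum K C](weights x y) !split_head.
exact: (riemann_hypothesis_of_moments (prime_gt1 p_pr) pNE dN0 d0 nE A_d A'_d Ad0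
         match_A match_A' size_b roots).
Qed.
End NearlySelfDualCodes.

(** * The Golay codes *)

Definition golay23_generator : seq nat := [:: 1; 1; 0; 0; 0; 1; 1; 1; 0; 1; 0; 1]%N.
Definition golay11_generator : seq nat := [:: 2; 0; 1; 2; 1; 1]%N.

Definition golay23_weights : seq nat :=
  [:: 1; 0; 0; 0; 0; 0; 0; 253; 506; 0; 0; 1288;
      1288; 0; 0; 506; 253; 0; 0; 0; 0; 0; 0; 1]%N.
Definition golay23_dual_weights : seq nat :=
  [:: 1; 0; 0; 0; 0; 0; 0; 0; 506; 0; 0; 0; 1288; 0; 0; 0; 253; 0; 0; 0; 0; 0; 0; 0]%N.
Definition golay11_weights : seq nat := [:: 1; 0; 0; 0; 0; 132; 132; 0; 330; 110; 0; 24]%N.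
Definition golay11_dual_weights : seq nat := [:: 1; 0; 0; 0; 0; 0; 132; 0; 0; 110; 0; 0]%N.

(** 12597 times the zeta polynomial of the extended binary Golay code.  It comes
    from the weights by solving the equations of [moments_match]; 12597 clears
    the denominators. *)
Definition golay23_zeta : seq N :=
  [:: 13; 78; 260; 624; 1182; 1836; 2364; 2496; 2080; 1248; 416]%num.

(** 7 times the zeta polynomial of the extended ternary Golay code. *)
Definition golay11_zeta : seq N := [:: 1; 3; 3]%num.

Lemma golay23_generatorE :
  'X^11 + 'X^9 + 'X^7 + 'X^6 + 'X^5 + 'X + 1 = word_poly 2 golay23_generator.
Proof.
rewrite /word_poly /= !cons_poly_def polyC0.
have -> : 1%:R%:P = 1 :> {poly 'F_2} by [].
by ring.
Qed.

Lemma golay11_generatorE :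
  'X^5 + 'X^4 - 'X^3 + 'X^2 - 1 = word_poly 3 golay11_generator.
Proof.
rewrite /word_poly /= !cons_poly_def polyC0.
have -> : 2%:R = -1 :> 'F_3 by apply: val_inj.
have -> : 1%:R%:P = 1 :> {poly 'F_3} by [].
by rewrite polyCN; ring.
Qed.

Lemma golay23_distribution : weight_distribution 2 23 golay23_generator 12 = golay23_weights.
Proof. by vm_compute. Qed.

Lemma golay11_distribution : weight_distribution 3 11 golay11_generator 6 = golay11_weights.
Proof. by vm_compute. Qed.

Lemma golay23_transform (A : comNzRingType) (x y : A) :
  sparse_form (x + 1 * y) (x - y) 23 0 golay23_weights =
  2 ^+ 12 * sparse_form x y 23 0 golay23_dual_weights.
Proof. by rewrite /=; ring. Qed.

Lemma golay11_transform (A : comNzRingType) (x y : A) :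
  sparse_form (x + 2 * y) (x - y) 11 0 golay11_weights =
  3 ^+ 6 * sparse_form x y 11 0 golay11_dual_weights.
Proof. by rewrite /=; ring. Qed.

Lemma golay23_zeta_roots (R : realType) (z : R[i]) :
  root ((castN R[i] 12597)^-1 *: Poly (map (castN R[i]) golay23_zeta)) z ->
  `|z| = (sqrtC 2)^-1.
Proof.
have d0 : (castN R[i] 12597)^-1 != 0 by rewrite invr_eq0 pnatr_eq0.
rewrite (rootZ _ _ d0) rootE horner_Poly.
have -> : map (castN R[i]) golay23_zeta =
    [:: 13; 78; 260; 624; 1182; 1836; 2364; 2496; 2080; 1248; 416] by [].
rewrite /= => /eqP Pz.
have z0 : z != 0.
  by apply: contra_eqN Pz => /eqP ->; rewrite mulr0 add0r pnatr_eq0.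
have [v uE v8] : exists2 v : R, 2 * z + z^-1 = (v%:C)%C & v ^+ 2 < 8.
  apply: golay_quintic_complex_root; apply: (mulfI (expf_neq0 5 z0)).
  by rewrite mulr0 -[RHS]Pz; field.
have v_real : (v%:C)%C \is Num.real by rewrite complex_real.
have v_small : (v%:C)%C ^+ 2 < 4 * 2%:R.
  by rewrite -rmorphXn -natrM -(rmorph_nat (real_complex R)) ltcR.
exact: (norm_of_real_sum _ z0 v_real v_small uE).
Qed.

Lemma golay11_zeta_roots (K : numClosedFieldType) (z : K) :
  root ((castN K 7)^-1 *: Poly (map (castN K) golay11_zeta)) z ->
  `|z| = (sqrtC 3)^-1.
Proof.
have d0 : (castN K 7)^-1 != 0 by rewrite invr_eq0 pnatr_eq0.
rewrite (rootZ _ _ d0) rootE horner_Poly.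
have -> : map (castN K) golay11_zeta = [:: 1; 3; 3] by [].
rewrite /= => /eqP Pz.
have z0 : z != 0.
  by apply: contra_eqN Pz => /eqP ->; rewrite mulr0 add0r oner_eq0.
apply: (@norm_of_real_sum _ 3 _ z (- 3)) => //; first by rewrite rpredN rpred_nat.
  by rewrite sqrrN -natrX -natrM ltr_nat.
by apply: (mulfI z0); apply/eqP; rewrite -subr_eq0 -Pz; apply/eqP; field.
Qed.

Theorem theorem1p8 (R : realType) :
  (forall C : {vspace 'rV['F_2]_23}, binary_golay C ->
     sigma_invariant 2 (tilde_weight_enum R[i] C) /\
     riemann_hypothesis 2 (tilde_weight_enum R[i] C)) /\
  (forall C : {vspace 'rV['F_3]_11}, ternary_golay C ->
     sigma_invariant 3 (tilde_weight_enum R[i] C) /\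
     riemann_hypothesis 3 (tilde_weight_enum R[i] C)).
Proof.
split=> C CD; split; try exact: tilde_weight_enum_invariant.
  move: CD; rewrite /binary_golay golay23_generatorE => CD.
  apply: (@riemann_hypothesis_of_weights _ 2 23 12 7 15 (behead golay23_weights)
    (behead golay23_dual_weights) 2 12597 golay23_zeta) => //.
  - by rewrite pnatr_eq0.
  - by rewrite (dim_equiv _ CD) // dim_generated.
  - by move=> u v; rewrite (enumerator_equiv _ _ CD) enumerator_generated // golay23_distribution.
  - exact: golay23_transform.
  - exact: golay23_zeta_roots.
move: CD; rewrite /ternary_golay golay11_generatorE => CD.
apply: (@riemann_hypothesis_of_weights _ 3 11 6 5 5 (behead golay11_weights)
    (behead golay11_dual_weights) 3 7 golay11_zeta) => //.
- by rewrite pnatr_eq0.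
- by rewrite (dim_equiv _ CD) // dim_generated.
- by move=> u v; rewrite (enumerator_equiv _ _ CD) enumerator_generated // golay11_distribution.
- exact: golay11_transform.
- exact: golay11_zeta_roots.
Qed.
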